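(* Let $(S,+, \cdot, -, \ast)$ be a dual weak left $\star$-brace and $z \in \mathcal{D}_r(S)$. For $w\in S$ define maps $r_w,\check{r}_w: S\times S\to S\times S$ by $$r_w(a,b)=\left(w^\ast w (-a w+a b w)w^\ast w,\ \left(w^\ast w (-a w+a b w)w^\ast w\right)^\ast ab\right),$$ $$\check{r}_{w}(a,b)=\left((ab-aw+w)ww^\ast, \ \left((ab-aw+w)ww^\ast\right)^\ast ab \right)$$ for all $a,b\in S$. Then $\check{r}_{z}$ is a solution of the Yang-Baxter equation. Moreover, $$r_{z}\, \check{r}_{z^\ast}\, r_{z} = r_{z}, \qquad \check{r}_{z^\ast}\, r_{z}\, \check{r}_{z^\ast}= \check{r}_{z^\ast}, \qquad r_{z}\,\check{r}_{z^\ast} = \check{r}_{z^\ast}\,r_{z}.$$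
   Context: A regular $\star$-semigroup $(S,\cdot,\ast)$ is a semigroup $(S,\cdot)$ with a unary operation $x\mapsto x^\ast$ satisfying $xx^\ast x=x$, $(x^\ast)^\ast=x$, $(xy)^\ast=y^\ast x^\ast$ for all $x,y\in S$. A weak left $\star$-brace $(S,+,\cdot,-,\ast)$ consists of a set $S$ such that $(S,+,-)$ and $(S,\cdot,\ast)$ are regular $\star$-semigroups (with unary operations $x\mapsto -x$ and $x\mapsto x^\ast$ respectively; $+$ need not be commutative) and $x(y+z)=xy-x+xz$ and $-x+x=xx^\ast$ for all $x,y,z\in S$. Here $xy=x\cdot y$, $x-y$ means $x+(-y)$, and multiplication has higher precedence than addition. It is a dual weak left $\star$-brace if moreover $x-x=x^\ast x$ for all $x\in S$. The set of right distributors of a dual weak left $\star$-brace $S$ is $\mathcal{D}_r(S)=\{z\in S\mid (a+b)z=az-z+bz \text{ for all } a,b\in S\}$. A map $r:S\times S\to S\times S$ is a (set-theoretic) solution of the Yang-Baxter equation if $(r\times \mathrm{id}_S)(\mathrm{id}_S\times r)(r\times \mathrm{id}_S)=(\mathrm{id}_S\times r)(r\times \mathrm{id}_S)(\mathrm{id}_S\times r)$ as maps $S\times S\times S\to S\times S\times S$; no bijectivity or non-degeneracy is required. Juxtaposition of maps denotes composition. *)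

(* Defs.v *)
From mathcomp Require Import ssreflect ssrfun.

Set Implicit Arguments.
Unset Strict Implicit.
Unset Printing Implicit Defensive.

Record regular_star_semigroup (S : Type) (op : S -> S -> S) (inv : S -> S) :
    Prop := RegularStarSemigroup {
  rss_assoc : associative op;
  rss_regular : forall x, op (op x (inv x)) x = x;
  rss_invK : involutive inv;
  rss_invM : forall x y, inv (op x y) = op (inv y) (inv x)
}.

Declare Scope brace_scope.
Delimit Scope brace_scope with brace.

Record weakLeftStarBrace := WeakLeftStarBrace {
  wb_sort :> Type;
  wb_add : wb_sort -> wb_sort -> wb_sort;
  wb_mul : wb_sort -> wb_sort -> wb_sort;
  wb_opp : wb_sort -> wb_sort;
  wb_star : wb_sort -> wb_sort;
  wb_add_rss : regular_star_semigroup wb_add wb_opp;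
  wb_mul_rss : regular_star_semigroup wb_mul wb_star;
  wb_distr : forall x y z,
    wb_mul x (wb_add y z) =
    wb_add (wb_add (wb_mul x y) (wb_opp x)) (wb_mul x z);
  wb_idem : forall x, wb_add (wb_opp x) x = wb_mul x (wb_star x)
}.

Arguments wb_add {w} _ _.
Arguments wb_mul {w} _ _.
Arguments wb_opp {w} _.
Arguments wb_star {w} _.

(* Rocq's default precedences make [- x * y] parse as [(- x) * y], whereas in a
   brace the product binds more tightly than the minus sign.  The opposite of a
   product is therefore always written [- (x * y)] below. *)
Notation "x + y" := (wb_add x y) : brace_scope.
Notation "x * y" := (wb_mul x y) : brace_scope.
Notation "- x" := (wb_opp x) : brace_scope.
Notation "x - y" := (wb_add x (wb_opp y)) : brace_scope.
Notation "x ^*" := (wb_star x) : brace_scope.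

Local Open Scope brace_scope.

Definition is_dual (S : weakLeftStarBrace) : Prop :=
  forall x : S, x - x = x^* * x.

Definition right_distributor (S : weakLeftStarBrace) (z : S) : Prop :=
  forall a b : S, (a + b) * z = a * z - z + b * z.

Definition r_map (S : weakLeftStarBrace) (w : S) (p : S * S) : S * S :=
  let: (a, b) := p in
  let u := w^* * w * (- (a * w) + a * b * w) * w^* * w in
  (u, u^* * (a * b)).

Definition rcheck_map (S : weakLeftStarBrace) (w : S) (p : S * S) : S * S :=
  let: (a, b) := p in
  let u := (a * b - a * w + w) * w * w^* in
  (u, u^* * (a * b)).

Definition map12 (X : Type) (r : X * X -> X * X) (t : X * X * X) : X * X * X :=
  let: (a, b, c) := t in let: (a', b') := r (a, b) in (a', b', c).

Definition map23 (X : Type) (r : X * X -> X * X) (t : X * X * X) : X * X * X :=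
  let: (a, b, c) := t in let: (b', c') := r (b, c) in (a, b', c').

Definition YBE_solution (X : Type) (r : X * X -> X * X) : Prop :=
  map12 r \o map23 r \o map12 r =1 map23 r \o map12 r \o map23 r.

(* Main.v *)
From Stdlib Require Import ProofIrrelevance.
Require Import Defs.
From mathcomp Require Import ssreflect ssrfun.

(** In a dual weak left star-brace a projection [e] satisfies [e * x = x + e]
    and [x * e = e + x]. Distributivity then forces both semigroups to be
    completely regular with locally commuting projections, so a projection
    may be moved freely inside a word of either operation as long as the end
    letters stay in place. Hence [x |-> e * x * e] preserves all operations,
    and it maps every element whose support dominates [e] into the maximal
    subgroup with identity [e] of both semigroups, which is a skew brace.
    For given arguments let [e] be the projection [w * w^*] of their product
    [w]: the required identities hold after applying this map, by a
    computation in a skew brace, and they lift back because both sides have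
    the same support and their left and right projections lie below common
    projections. *)

Set Implicit Arguments.
Unset Strict Implicit.
Unset Printing Implicit Defensive.

(** * Completely regular star-semigroups whose projections satisfy a normality law *)

Section NormalOrthogroup.

Variables (T : Type) (op : T -> T -> T) (inv : T -> T).
Hypothesis rssT : regular_star_semigroup op inv.

Local Notation "x * y" := (op x y).
Local Notation "x ^*" := (inv x).

Definition projection (e : T) : Prop := e * e = e /\ e^* = e.

Lemma opA x y w : x * (y * w) = x * y * w.
Proof. exact: (rss_assoc rssT). Qed.

Lemma op_inv_op x : x * x^* * x = x.
Proof. exact: (rss_regular rssT). Qed.

Lemma opinvK x : x^*^* = x.
Proof. exact: (rss_invK rssT). Qed.

Lemma opinvM x y : (x * y)^* = y^* * x^*.
Proof. exact: (rss_invM rssT). Qed.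

Lemma projection_left x : projection (x * x^*).
Proof. by split; rewrite ?opA ?op_inv_op // opinvM opinvK. Qed.

Lemma projection_right x : projection (x^* * x).
Proof. by move: (projection_left x^*); rewrite opinvK. Qed.

Lemma inv_op_inv x : x^* * x * x^* = x^*.
Proof. by move: (op_inv_op x^*); rewrite opinvK. Qed.

Lemma projection_conj x e : projection e -> projection (x * e * x^*).
Proof.
move=> [ee ev]; have := projection_left (x * e).
by rewrite opinvM ev !opA -(opA x e e) ee.
Qed.

Lemma projection_sandwich e f : projection e -> projection f ->
  projection (e * f * e).
Proof. by move=> [_ ev] pf; have := projection_conj e pf; rewrite ev. Qed.

Lemma projection_mul_idem e f : projection e -> projection f ->
  e * f * e * f = e * f.
Proof.
move=> [ee ev] [ff fv]; have := op_inv_op (e * f).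
by rewrite opinvM ev fv !opA -(opA e f f) ff -(opA _ e e) ee.
Qed.

Lemma projection_mulC e f : projection e -> projection f ->
  e * f = f -> f * e = f.
Proof. by move=> [_ ev] [_ fv] /(congr1 inv); rewrite opinvM ev fv. Qed.

(** The two hypotheses are verified later for the addition and for the multiplication of a dual weak
    left star-brace, so this section applies to both. *)
Hypothesis normal : forall e f g, projection e -> projection f ->
  projection g -> f * g * e = f * e * g * e.
Hypothesis completely_regular : forall x,
  x^* * x * (x * x^*) * (x^* * x) = x^* * x.

Lemma normal_left e f g : projection e -> projection f -> projection g ->
  e * g * f = e * g * e * f.
Proof.
move=> pe pf pg; have := congr1 inv (normal pe pf pg).
by rewrite !opinvM pe.2 pf.2 pg.2 !opA.
Qed.

Lemma local_projC e f g : projection e -> projection f -> projection g ->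
  e * f * g * e = e * g * f * e.
Proof.
move=> pe pf pg; have H := normal_left pg pe pf.
by rewrite -(opA e g f) -(opA e _ e) H !opA (normal pg pe pf).
Qed.

(** Normality inserts copies of [e] around the middle factors, which then commute by
    [local_projC]. *)
Lemma normal_projC e f g h :
  projection e -> projection f -> projection g -> projection h ->
  e * f * g * h = e * g * f * h.
Proof.
move=> pe pf pg ph.
have expand x y : projection x -> projection y ->
    e * x * y * h = e * x * e * y * e * h.
  move=> px py; rewrite (normal_left pe py px) -!(opA (e * x)).
  by rewrite (normal_left pe ph py) !opA.
rewrite expand // expand //; congr (_ * h).
have := local_projC pe (projection_sandwich pe pf) (projection_sandwich pe pg).
by rewrite !opA pe.1 -!(opA _ e e) pe.1.
Qed.

(* A completely regular monoid with commuting projections is a Clifford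
   semigroup. *)
Lemma local_group e x : projection e -> e * x = x -> x * e = x ->
  x * x^* = x^* * x.
Proof.
move=> pe ex xe.
have xve : x^* * e = x^* by rewrite -{2}ex opinvM pe.2.
have exv : e * x^* = x^* by rewrite -{2}xe opinvM pe.2.
have pl := projection_right x; have pr := projection_left x.
have C : x^* * x * (x * x^*) = x * x^* * (x^* * x).
  have := local_projC pe pl pr.
  by rewrite !opA exv ex -!opA xe xve.
have Hl := completely_regular x; have := completely_regular x^*.
rewrite opinvK => Hr; rewrite -Hr -C -opA pr.1 -[RHS]Hl.
by rewrite -(opA (x^* * x)) -C !opA -!(opA _ x^* x) pl.1.
Qed.

Lemma local_projection_central e f x : projection e -> projection f ->
  e * f = f -> e * x = x -> x * e = x -> x * f = f * x.
Proof.
move=> pe pf ef ex xe.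
have fe := projection_mulC pe pf ef.
have xC := local_group pe ex xe.
have C : f * (x^* * x) = x^* * x * f.
  have xve : x^* * e = x^* by rewrite -{2}ex opinvM pe.2.
  have exv : e * x^* = x^* by rewrite -{2}xe opinvM pe.2.
  have := local_projC pe pf (projection_right x); rewrite opA.
  by rewrite !opA ef -!(opA _ _ e) xe fe exv.
have C' : x * f * x^* = f * (x^* * x).
  have := @local_group e (x * f) pe; rewrite opA ex -opA fe.
  move=> /(_ erefl erefl); rewrite opinvM pf.2 !opA -(opA x) pf.1 => ->.
  by rewrite -(opA f) -opA -C opA pf.1.
rewrite -{1}(op_inv_op x) -!opA (opA x^*) -C !opA.
by rewrite C' -opA -xC op_inv_op.
Qed.

(** In the local monoid at [s] the projection [s * f * s] is central, so it commutes with
    [s * x * t * s]; normality inserts and removes the inner copies of [s]. *)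
Lemma projection_moves_local s t f x :
  projection s -> projection t -> projection f ->
  s * f * x * t * s = s * x * f * t * s.
Proof.
move=> ps pt pf.
have -> : s * f * x * t * s = s * f * s * (s * x * t * s).
  rewrite -{1}(op_inv_op x) !opA.
  have := normal_left ps (projection_left x) pf; rewrite !opA => ->.
  by rewrite -!opA (opA x) (opA (x * _)) op_inv_op (opA s s) ps.1.
have ps1 := projection_sandwich ps pf.
rewrite -(@local_projection_central s (s * f * s) (s * x * t * s)) //;
  do ?[by rewrite ?opA ?ps.1 // -?opA ps.1].
rewrite -(op_inv_op x) -!opA; congr (s * (x * _)).
rewrite !opA; set n := x^* * x; have pn : projection n := projection_right x.
rewrite -(opA _ s s) ps.1 (normal_projC pn pf pt ps).
by rewrite -!opA (opA t f s) (normal ps pt pf) !opA.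
Qed.

(** By complete regularity [u] and [u * s] generate the same right ideal, and the left projection
    depends only on that ideal. *)
Lemma op_inv_truncate s u : projection s -> s * u = u ->
  u * s * (u * s)^* = u * u^*.
Proof.
move=> ps su.
have uE : u = u * s * (u * u^* * (u^* * u)).
  have := congr1 (op u) (completely_regular u).
  by rewrite -(opA u s) !(opA s) su !opA op_inv_op => ->.
set k := u * s.
have ku : k * k^* * u = u.
  by have := congr1 (op (k * k^*)) uE; rewrite -/k (opA _ k) op_inv_op -uE.
have [_ <-] := projection_left k.
have uk : u * u^* * k = k by rewrite /k opA op_inv_op.
have e1 : k * k^* * (u * u^*) = u * u^* by rewrite opA ku.
have e2 : u * u^* * (k * k^*) = k * k^* by rewrite opA uk.
by rewrite -e2 opinvM !(projection_left _).2 e1.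
Qed.

(** The outer letters may be replaced by the projections [s] and [t] next to them. An element [w]
    with [s * w = w] is then determined by [w * s], [w * w^*] and [w^* * w], and these agree for
    both sides: the first by the local version, the others by [op_inv_truncate]. *)
Theorem projection_moves f x y z : projection f ->
  y * f * x * z = y * x * f * z.
Proof.
move=> pf; set s := y^* * y; set t := z * z^*.
have ps : projection s := projection_right y.
have pt : projection t := projection_left z.
suff E : s * f * x * t = s * x * f * t.
  have := congr1 (fun q => y * q * z) E.
  by rewrite /s /t !opA op_inv_op -!opA (opA z) op_inv_op.
move: {y z} s t ps pt => s t ps pt.
have key s' t' x' : projection s' -> projection t' ->
    s' * f * x' * t' * (s' * f * x' * t')^* =
    s' * x' * f * t' * (s' * x' * f * t')^*.
  move=> ps' pt'.
  rewrite -[LHS](op_inv_truncate ps') ?opA ?ps'.1 //.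
  rewrite -[RHS](op_inv_truncate ps') ?opA ?ps'.1 //.
  by rewrite projection_moves_local.
set u := s * f * x * t; set v := s * x * f * t.
have lE : u * u^* = v * v^* by apply: key.
have rE : u^* * u = v^* * v.
  have := key t s x^* pt ps.
  by rewrite /u /v !opinvM ps.2 pt.2 pf.2 opinvK !opA => ->.
have decomp w : s * w = w -> w * s * (w * w^*) * (w^* * w) = w.
  move=> sw; rewrite -(opA w s) (opA s) sw.
  by have := congr1 (op w) (completely_regular w); rewrite !opA op_inv_op.
have <- : u * s * (u * u^*) * (u^* * u) = u by rewrite decomp // !opA ps.1.
have <- : v * s * (v * v^*) * (v^* * v) = v by rewrite decomp // !opA ps.1.
have -> : u * s = v * s by apply: projection_moves_local.
by rewrite lE rE.
Qed.

(** * The ideal preorder and the effect of sandwiching by a projection *)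

Definition below t x := exists y w, t = y * x * w.

Lemma below_trans t x x' : below t x -> below x x' -> below t x'.
Proof.
move=> [y [w ->]] [y' [w' ->]]; exists (y * y'), (w' * w).
by rewrite !opA.
Qed.

(** The projection [x * x^*] can be moved along the word for [p * p^*] until it meets [x], which
    absorbs it. *)
Lemma below_support t x : below t x ->
  t * t^* * (x * x^*) * (t * t^*) = t * t^*.
Proof.
move=> [y [w ->]]; set p := y * x * w.
have E : p * p^* = y * (x * (w * p^*)) by rewrite !opA.
rewrite {2}E opA projection_moves; last exact: projection_left.
by rewrite -(opA (_ * y)) (opA (x * x^*)) op_inv_op -opA -E (projection_left p).1.
Qed.

(* Sandwiching by [e] forgets only the one-sided supports of an element lying
   below [e], and those are pinned down by [p] and [q]. *)
Lemma sandwich_inj e p q u v :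
  projection e -> projection p -> projection q ->
  below u e -> below v e -> below u^* e -> below v^* e ->
  p * u = u -> p * v = v -> u * q = u -> v * q = v ->
  e * u * e = e * v * e -> u = v.
Proof.
move=> pe.
(* When [w^*] lies below [e], [w * e * w^* = w * w^*], so taking left projections commutes with
   sandwiching. *)
have conj_support w : below w^* e -> e * w * e * (e * w * e)^* = e * (w * w^*) * e.
  move=> /below_support; rewrite opinvK pe.2 pe.1 => H.
  have E : w * e * w^* = w * w^*.
    have := congr1 (fun h => w * h * w^*) H.
    by rewrite !opA op_inv_op -!(opA (w * e)) inv_op_inv.
  by rewrite !opinvM pe.2 !opA -(opA _ e e) pe.1 -!(opA e) E.
(* Projections under a common [p'] commute. Equal sandwiches give [l = l * l' * e * l], whence [l']
   absorbs [l]; used in both directions this yields [l = l']. *)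
have absorb l l' p' : projection l -> projection l' -> projection p' ->
    p' * l = l -> p' * l' = l' -> l * e * l = l -> e * l * e = e * l' * e ->
    l' * l = l.
  move=> pl pl' pp' p'l p'l' lel ll'.
  have C : l' * l = l * l'.
    have := local_projC pp' pl pl'; rewrite p'l p'l' -!opA.
    by rewrite (projection_mulC pp' pl) // (projection_mulC pp' pl').
  have E : l = l * l' * e * l.
    have := congr1 (fun h => l * h * l) ll'; rewrite !opA lel lel => {1}->.
    by rewrite -(projection_moves e l e pl') -(opA _ e e) pe.1.
  by rewrite {1}E !opA C -(opA l) pl'.1 -E.
have left_support p' u' v' : projection p' -> below u' e -> below v' e ->
   below u'^* e -> below v'^* e -> p' * u' = u' -> p' * v' = v' ->
   e * u' * e = e * v' * e -> u' * u'^* = v' * v'^*.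
  move=> pp' /below_support lu /below_support lv ue' ve' pu pv uv.
  have := conj_support u' ue'; rewrite uv conj_support // => E.
  rewrite pe.2 pe.1 in lu lv.
  have pl := projection_left u'; have pl' := projection_left v'.
  have pl_u : p' * (u' * u'^*) = u' * u'^* by rewrite opA pu.
  have pl_v : p' * (v' * v'^*) = v' * v'^* by rewrite opA pv.
  have lE := absorb _ _ p' pl pl' pp' pl_u pl_v lu (esym E).
  rewrite -[LHS](projection_mulC pl' pl lE).
  exact: (absorb _ _ p' pl' pl pp' pl_v pl_u lv E).
move=> pp pq ue ve ue' ve' pu pv uq vq uv.
have lE : u * u^* = v * v^* by apply: (left_support p).
have rE : u^* * u = v^* * v.
  have := left_support q u^* v^*; rewrite !opinvK; apply=> //.
  - by rewrite -[in RHS]uq opinvM pq.2.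
  - by rewrite -[in RHS]vq opinvM pq.2.
  - by have := congr1 inv uv; rewrite !opinvM pe.2 !opA.
(* An element below [e] is recovered from its sandwich and its two projections. *)
have decomp w : below w e -> below w^* e ->
    w = w * w^* * (e * w * e) * (w^* * w).
  move=> /below_support H /below_support H'.
  have {}H : w * w^* * e * w = w.
    have := congr1 (fun h => h * w) H.
    by rewrite pe.2 pe.1 -!(opA _ (w * w^*) w) op_inv_op.
  have {}H' : w * e * (w^* * w) = w.
    have := congr1 (op w) H'.
    by rewrite opinvK pe.2 pe.1 !opA op_inv_op.
  by rewrite !opA H -opA H'.
by rewrite (decomp u) // (decomp v) // lE rE uv.
Qed.

(** With [r = t * t^*], an extra copy of [r] can be moved between [x^* * x] and [y * y^*]; by
    [below_support] the whole word then collapses to [r], and it contains [x * y] as a factor. *)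
Lemma below_mul t x y : below t x -> below t y -> below t (x * y).
Proof.
move=> tx ty; set r := t * t^*; have pr : projection r := projection_left t.
have tx' : below t (x^* * x).
  by have [a [b ->]] := tx; exists (a * x), b; rewrite !opA -(opA a x x^*) -(opA a _ x) op_inv_op.
have [_ hx] := projection_right x.
have := below_support ty; have := below_support tx'.
rewrite hx (projection_right x).1 -/r => Hx Hy.
exists (r * x^*), (y^* * r * t).
have E : r * (x^* * x) * (y * y^*) * r = r.
  by rewrite -opA -{1}pr.1 projection_moves // Hx opA Hy.
by have := congr1 (fun h => h * t) E; rewrite op_inv_op !opA => ->.
Qed.

Lemma sandwich_mul e x y : projection e ->
  e * (x * y) * e = e * x * e * (e * y * e).
Proof.
move=> pe; rewrite !opA -(opA _ e e) pe.1 -!(opA _ y e).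
by rewrite -(projection_moves _ _ _ pe) pe.1.
Qed.

End NormalOrthogroup.

Local Open Scope brace_scope.

(** * Projections in a dual weak left star-brace, and normality and complete regularity of both
    operations *)

Section DualBrace.

Variable S : weakLeftStarBrace.
Hypothesis dualS : is_dual S.
Implicit Types x y e f g : S.

Let rssA := wb_add_rss S.
Let rssM := wb_mul_rss S.
Local Notation proj := (projection wb_mul wb_star).
Local Notation addA := (opA rssA).
Local Notation mulA := (opA rssM).

Lemma proj_opp e : proj e -> - e = e.
Proof.
move=> [ee ev]; have := wb_idem e; rewrite ev ee => H.
by rewrite -{1}H (opinvM rssA) (opinvK rssA).
Qed.

Lemma proj_addxx e : proj e -> e + e = e.
Proof.
by move=> pe; have := wb_idem e; rewrite pe.2 pe.1 (proj_opp pe).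
Qed.

Lemma proj_add e : proj e -> projection wb_add wb_opp e.
Proof. by move=> pe; split; [exact: proj_addxx | exact: proj_opp]. Qed.

Lemma add_proj e : projection wb_add wb_opp e -> proj e.
Proof.
move=> [ee ev]; have := wb_idem e; rewrite ev ee => ->.
exact: (projection_left rssM).
Qed.

Lemma proj_distr e x y : proj e -> e * (x + y) = e * x + e + e * y.
Proof. by move=> pe; rewrite wb_distr (proj_opp pe). Qed.

Lemma star_mul_add x : x^* * x + x = x.
Proof. by rewrite -dualS (op_inv_op rssA). Qed.

Lemma add_mul_star x : x + x * x^* = x.
Proof. by rewrite -wb_idem addA (op_inv_op rssA). Qed.

Lemma opp_star x : (- x)^* * (- x) = x * x^*.
Proof. by rewrite -dualS (opinvK rssA) wb_idem. Qed.

Lemma mul_opp_star x : - x * (- x)^* = x^* * x.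
Proof. by rewrite -wb_idem (opinvK rssA) dualS. Qed.

(** For [x = e + f] the two axioms linking the operations give [x^* * x = e] and
    [x * x^* = f + e + f]. Distributivity then shows that [e] is absorbed by [x * x^*] and by [x^*],
    so [x = x * e = x * x^* * e = e]. *)
Lemma proj_add_of_mul e f : proj e -> proj f -> f * e = e -> e + f = e.
Proof.
move=> pe pf fe; have ef := projection_mulC rssM pf pe fe.
have efe : e + f + e = e.
  by have := proj_distr e e pf; rewrite (proj_addxx pe) fe.
set x := e + f.
have lx : x^* * x = e.
  rewrite -dualS (opinvM rssA) !proj_opp // addA -(addA e) (proj_addxx pf).
  exact: efe.
have rx : x * x^* = f + e + f.
  by rewrite -wb_idem (opinvM rssA) !proj_opp // addA -(addA f) (proj_addxx pe).
have ex : e * x = e.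
  by rewrite proj_distr // ef pe.1 !(proj_addxx pe).
have er : e * (x * x^*) = e.
  by rewrite rx !proj_distr // ef pe.1 !(proj_addxx pe).
have re : x * x^* * e = e.
  by have := congr1 wb_star er; rewrite (opinvM rssM) pe.2 (projection_left rssM x).2.
have xe : x * e = x by rewrite -lx mulA (op_inv_op rssM).
have xse : x^* * e = e by have := congr1 wb_star ex; rewrite (opinvM rssM) pe.2.
by rewrite -/x -xe -{1}xse mulA re.
Qed.

Lemma add_absorb e x : proj e -> e * x = x -> x + e = x.
Proof.
move=> pe ex; have pr := projection_left rssM x.
by rewrite -(add_mul_star x) -addA (proj_add_of_mul pr pe) // mulA ex.
Qed.

Lemma mul_absorb e x : proj e -> x + e = x -> e * x = x.
Proof.
move=> pe; have pr := projection_left rssM x.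
have key f : proj f -> f + e = f -> e * f = f.
  move=> pf fe.
  have ef : e + f = f.
    by have := congr1 wb_opp fe; rewrite (opinvM rssA) !proj_opp.
  have fE : f * e = f.
    rewrite -{2}pf.1 -{3}ef proj_distr // pf.1 -addA (proj_addxx pf).
    by rewrite add_absorb // mulA pf.1.
  by have := congr1 wb_star fE; rewrite (opinvM rssM) pe.2 pf.2.
by move=> xe; rewrite -(op_inv_op rssM x) mulA key // -wb_idem -addA xe.
Qed.

(** Both sides equal [e * (x + e)]: once by distributivity, once because [x + e] is absorbed by
    [e]. *)
Lemma proj_mul e x : proj e -> e * x = x + e.
Proof.
move=> pe; rewrite -[RHS](mul_absorb pe) ?proj_distr //.
  by rewrite pe.1 -addA (proj_addxx pe) add_absorb // mulA pe.1.
by rewrite -addA (proj_addxx pe).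
Qed.

(** The projection [g = x * e * x^*] satisfies [g * x = x * e], so [x * e = x + g] by [proj_mul].
    Duality for this element gives [e = x + g - x], and adding [x] on the right finishes. *)
Lemma mul_proj_le x e : proj e -> x^* * x * e = e -> x * e = e + x.
Proof.
move=> pe le; set q := x * e; set g := q * x^*.
have qx : q^* = e * x^* by rewrite (opinvM rssM) pe.2.
have pg : proj g by apply: (projection_conj rssM).
have gx : g * x = q.
  by rewrite /g /q -!mulA (projection_mulC rssM _ pe le) //; apply: projection_right.
have qE : q = x + g by rewrite -proj_mul.
have eE : e = x + g - x.
  have := dualS q; rewrite qx [in RHS]/q mulA -(mulA e) -mulA le pe.1 => <-.
  by rewrite qE (opinvM rssA) (proj_opp pg) addA -(addA x) (proj_addxx pg).
rewrite [in RHS]eE -addA wb_idem -addA.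
have pr := projection_left rssM x.
by rewrite (add_absorb pr) // /g /q !mulA (op_inv_op rssM).
Qed.

Lemma mul_proj x e : proj e -> x * e = e + x.
Proof.
move=> pe; set q := x * e.
have [l lE] : {l | l = x^* * x} by exists (x^* * x).
have pl : proj l by rewrite lE; exact: (projection_right rssM).
have lx : l + x = x by rewrite lE; exact: star_mul_add.
have xl : x * l = x by rewrite lE mulA (op_inv_op rssM).
have lxs : l * x^* = x^* by rewrite lE (inv_op_inv rssM).
have plel : proj (l * e * l) := projection_sandwich rssM pl pe.
have lelE : l * e * l = l + e + l by rewrite -mulA !proj_mul.
(* Distributivity over [e + e = e] gives [q - x + q = q]; this is substituted into
   [- q + q - q = - q] and the result is negated. *)
have q_reg : q = q^* * q + x + q * q^*.
  have H : q - x + q = q by rewrite -wb_distr (proj_addxx pe).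
  have := congr1 (fun h => - (- q + h - q)) H.
  rewrite /= (inv_op_inv rssA) (opinvK rssA) => {1}<-.
  rewrite -dualS -wb_idem !(opinvM rssA) !(opinvK rssA).
  by rewrite !addA.
(* Replacing [e] by [l * e * l] leaves [q * q^*] unchanged and makes [mul_proj_le] applicable. *)
have qq : q * q^* = - x + e + x.
  have : q * q^* = x * (l * e * l) * (x * (l * e * l))^*.
    rewrite (opinvM rssM x e) (opinvM rssM x (l * e * l)) pe.2 plel.2.
    rewrite -!(mulA x) (mulA e) pe.1 (mulA (l * e * l)) plel.1 !mulA xl.
    by rewrite -(mulA _ l) lxs.
  rewrite (mul_proj_le plel); last by rewrite -lE !mulA pl.1.
  move=> ->; rewrite -wb_idem (opinvM rssA) (proj_opp plel).
  have opx : - x + l = - x by rewrite -{2}lx (opinvM rssA) (proj_opp pl).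
  rewrite addA -(addA (- x) (l * e * l)) (proj_addxx plel) lelE !addA opx.
  by rewrite -(addA _ l) lx.
have ql : q^* * q = e + l + e.
  by rewrite /q (opinvM rssM) pe.2 mulA -(mulA e) -lE -mulA !proj_mul.
have idem := projection_mul_idem rssA (proj_add pe) (proj_add pl).
rewrite q_reg qq ql !addA -(addA _ x) dualS -lE idem.
by rewrite -{1}lx addA idem -addA lx.
Qed.

(** This is distributivity of [e] over [f + g], rewritten with [proj_mul]. *)
Lemma add_normal e f g :
  projection wb_add wb_opp e -> projection wb_add wb_opp f ->
  projection wb_add wb_opp g -> f + g + e = f + e + g + e.
Proof.
move=> /add_proj pe /add_proj pf /add_proj pg.
rewrite -(proj_mul _ pe) proj_distr // !proj_mul //.
by rewrite -!addA (addA e) (proj_addxx pe).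
Qed.

Lemma mul_normal e f g : proj e -> proj f -> proj g ->
  f * g * e = f * e * g * e.
Proof.
move=> pe pf pg; rewrite -!mulA (proj_mul (g * e) pf) (proj_mul (e * _) pf).
rewrite (proj_mul (g * e) pe) (proj_mul e pg).
exact: (normal_left rssA add_normal (proj_add pe) (proj_add pf) (proj_add pg)).
Qed.

(** The source of complete regularity for both operations: expanding [l = - x^* + x^*] produces
    [l + r + l + r + l], which shortens because a sum of two projections is idempotent. *)
Lemma star_mul_regular x : x^* * x + x * x^* + x^* * x = x^* * x.
Proof.
have [l lE] : {l | l = x^* * x} by exists (x^* * x).
have [r rE] : {r | r = x * x^*} by exists (x * x^*).
have pl : proj l by rewrite lE; exact: (projection_right rssM).
have pr : proj r by rewrite rE; exact: (projection_left rssM).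
have sE : - x^* + x^* = l by rewrite wb_idem (opinvK rssM) lE.
have sE' : x^* - x^* = r by rewrite dualS (opinvK rssM) rE.
set w := x^* * - x.
(* Distributivity applied to [x^* * (- x + x)], where [- x + x = x * x^*]. *)
have xsE : x^* = w - x^* + l.
  by rewrite /w lE -wb_distr wb_idem mulA (inv_op_inv rssM).
(* The elements [w] and [x^* * l] have the same left projection, because [- x] has left projection
   [x^* * x]. *)
have wE : - w + w = - x^* + l + x^*.
  have := wb_idem (x^* * l); rewrite (mul_proj _ pl) (opinvM rssA) (proj_opp pl).
  rewrite addA -(addA _ l l) (proj_addxx pl) => ->.
  rewrite -(mul_proj _ pl) wb_idem /w !(opinvM rssM) (opinvK rssM) pl.2.
  by rewrite !mulA -(mulA x^*) mul_opp_star -lE -(mulA x^* l l) pl.1.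
have E : l = l + r + l + r + l.
  have : l = - (w - x^* + l) + (w - x^* + l) by rewrite -xsE.
  rewrite !(opinvM rssA) (opinvK rssA) (proj_opp pl) !addA => {1}->.
  rewrite -(addA _ (- w)) wE !addA -(addA l x^*) sE'.
  by rewrite -(addA _ x^*) sE'.
rewrite -lE -rE [RHS]E.
by rewrite (projection_mul_idem rssA (proj_add pl) (proj_add pr)).
Qed.

Lemma add_completely_regular x :
  - x + x + (x - x) + (- x + x) = - x + x.
Proof.
by rewrite wb_idem dualS; have := star_mul_regular x^*; rewrite (opinvK rssM).
Qed.

Lemma mul_completely_regular x :
  x^* * x * (x * x^*) * (x^* * x) = x^* * x.
Proof.
have pl := projection_right rssM x; have pr := projection_left rssM x.
rewrite -mulA (proj_mul _ pl) (proj_mul _ pr).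
exact: star_mul_regular.
Qed.

End DualBrace.

(** * Skew braces: both operations are groups with the common identity [o] *)

Section SkewBrace.

Variables (T : weakLeftStarBrace) (o : T).
Hypothesis subrr : forall x : T, x - x = o.
Hypothesis addNr : forall x : T, - x + x = o.
Implicit Types x y a b c z : T.

Let rssA := wb_add_rss T.
Let rssM := wb_mul_rss T.
Local Notation addA := (opA rssA).
Local Notation mulA := (opA rssM).

Lemma skew_add0 x : o + x = x.
Proof. by rewrite -(subrr x) (op_inv_op rssA). Qed.

Lemma skew_addr0 x : x + o = x.
Proof. by rewrite -(addNr x) addA (op_inv_op rssA). Qed.

Lemma skew_opp0 : - o = o.
Proof. by rewrite -{1}(skew_add0 (- o)) subrr. Qed.

Lemma skew_addK x y : x + y - y = x.
Proof. by rewrite -addA subrr skew_addr0. Qed.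

Lemma skew_subK x y : x - y + y = x.
Proof. by rewrite -addA addNr skew_addr0. Qed.

Lemma skew_mulV x : x * x^* = o.
Proof. by rewrite -wb_idem addNr. Qed.

Lemma skew_Vmul x : x^* * x = o.
Proof. by rewrite -{2}(opinvK rssM x) skew_mulV. Qed.

Lemma skew_mul1 x : o * x = x.
Proof. by rewrite -(skew_mulV x) (op_inv_op rssM). Qed.

Lemma skew_mulr1 x : x * o = x.
Proof. by rewrite -(skew_Vmul x) mulA (op_inv_op rssM). Qed.

Lemma skew_mulKV x y : x * (x^* * y) = y.
Proof. by rewrite mulA skew_mulV skew_mul1. Qed.

Lemma skew_mulVK x y : x^* * (x * y) = y.
Proof. by rewrite mulA skew_Vmul skew_mul1. Qed.

Definition skew_simp := (opinvM rssA, opinvK rssA, addA, skew_add0, skew_addr0,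
  skew_opp0, subrr, addNr, skew_addK, skew_subK).

Lemma skew_mulN x y : x * (- y) = x - x * y + x.
Proof.
have := congr1 (fun h => x - x * y + h) (wb_distr x y (- y)).
by rewrite subrr skew_mulr1 !skew_simp => <-.
Qed.

(** Left multiplications preserve the heap operation [a - b + c]; [skew_sub3_mul] is the counterpart
    for right multiplication by a right distributor. *)
Lemma skew_mul_sub3 x a b c : x * (a - b + c) = x * a - x * b + x * c.
Proof. by rewrite !wb_distr skew_mulN !skew_simp. Qed.

Section RightDistributor.

Variable z : T.
Hypothesis zD : right_distributor z.

Lemma skew_Nmul x : (- x) * z = z - x * z + z.
Proof.
have := congr1 (fun h => z - x * z + h) (zD x (- x)).
by rewrite subrr skew_mul1 !skew_simp => <-.
Qed.

Lemma skew_sub3_mul a b c : (a - b + c) * z = a * z - b * z + c * z.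
Proof. by rewrite !zD skew_Nmul !skew_simp. Qed.

(** Right multiplication by [z] is a bijection preserving the heap operation, so its inverse
    preserves it too. *)
Lemma right_distributor_star : right_distributor z^*.
Proof.
move=> a b; set a' := a * z^*; set b' := b * z^*.
have -> : a = a' * z by rewrite -mulA skew_Vmul skew_mulr1.
have -> : b = b' * z by rewrite -mulA skew_Vmul skew_mulr1.
have -> : a' * z + b' * z = (a' - z^* + b') * z.
  by rewrite skew_sub3_mul skew_Vmul !skew_simp.
by rewrite -!mulA skew_mulV !skew_mulr1.
Qed.

Lemma skew_r_map a b : r_map z (a, b) =
  (- (a * z) + a * b * z, (- (a * z) + a * b * z)^* * (a * b)).
Proof. by rewrite /r_map skew_Vmul skew_mul1 -mulA skew_Vmul skew_mulr1. Qed.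

Lemma skew_rcheck_map a b : rcheck_map z (a, b) =
  (a * b - a * z + z, (a * b - a * z + z)^* * (a * b)).
Proof. by rewrite /rcheck_map -!(mulA _ z) skew_mulV skew_mulr1. Qed.

End RightDistributor.

(** By [s_mul] the first coordinate of both sides is [s (a * b) c]. The map preserves the product of
    its arguments, so once the second coordinates agree, so do the third ones. *)
Lemma skew_YBE z : right_distributor z -> YBE_solution (rcheck_map z).
Proof.
move=> zD; move: (skew_rcheck_map z); move: (rcheck_map z) => r.
pose s a b := a * b - a * z + z.
rewrite -[X in X -> _]/(forall a b, r (a, b) = (s a b, (s a b)^* * (a * b))).
have s_mul a b c : s a (s b c) = s (a * b) c.
  by rewrite /s skew_mul_sub3 !mulA !skew_simp.
move=> rE [[a b] c]; rewrite /= !rE /= !rE /= !rE !s_mul.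
rewrite !skew_mulKV; set t := s (a * b) c.
set d := s b c; set s1 := s a b; set b2 := s (s1^* * (a * b)) c.
set y := t^* * (a * d); set d' := d^* * (b * c).
have yd' : y * d' = t^* * (a * b * c).
  by rewrite /y /d' -!mulA skew_mulKV.
(* Equality of the second coordinates, multiplied by [t]. Both sides reduce to
   [a * b * c - a * z * z + z * z], by right distributivity of [z]. *)
have t_s1 : s1 * b2 = t * s y d'.
  have -> : s1 * b2 = a * b * c - a * b * z + s1 * z.
    by rewrite skew_mul_sub3 -!(mulA s1^*) !skew_mulKV.
  have -> : t * s y d' = a * b * c - a * d * z + t * z.
    by rewrite skew_mul_sub3 yd' -(mulA t^*) !skew_mulKV.
  by rewrite /d skew_mul_sub3 !skew_sub3_mul // !mulA !skew_simp.
rewrite yd' t_s1 skew_mulVK; congr (_, _, _).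
have <- : b2^* * (s1^* * (a * b * c)) = b2^* * (s1^* * (a * b) * c).
  by rewrite !mulA.
rewrite mulA -(opinvM rssM) t_s1 (opinvM rssM).
exact: (esym (mulA _ _ _)).
Qed.

(** Both maps preserve the product of the two components, so only the first component has to be
    recovered; the same holds for the reverse composite. *)
Lemma skew_r_rcheck z : right_distributor z ->
  r_map z \o rcheck_map z^* =1 id.
Proof.
move=> zD [a b].
have zE : (a * b - a * z^* + z^*) * z = a * b * z - a.
  by rewrite skew_sub3_mul // -(mulA a z^*) !skew_Vmul skew_mulr1 !skew_simp.
rewrite /comp skew_rcheck_map skew_r_map skew_mulKV zE.
have -> : - (a * b * z - a) + a * b * z = a by rewrite !skew_simp.
by rewrite skew_mulVK.
Qed.

Lemma skew_rcheck_r z : right_distributor z ->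
  rcheck_map z^* \o r_map z =1 id.
Proof.
move=> zD [a b]; have zD' := right_distributor_star zD.
have zE : (- (a * z) + a * b * z) * z^* = z^* - a + a * b.
  by rewrite zD' skew_Nmul // -!mulA !skew_mulV !skew_mulr1 !skew_simp.
rewrite /comp skew_r_map skew_rcheck_map skew_mulKV zE.
have -> : a * b - (z^* - a + a * b) + z^* = a by rewrite !skew_simp.
by rewrite skew_mulVK.
Qed.

End SkewBrace.

(** * Morphisms of braces and their compatibility with the maps on pairs and triples *)

Record brace_morphism (S T : weakLeftStarBrace) (f : S -> T) : Prop := {
  morph_add : forall x y, f (x + y) = f x + f y;
  morph_mul : forall x y, f (x * y) = f x * f y;
  morph_opp : forall x, f (- x) = - f x;
  morph_star : forall x, f x^* = (f x)^*
}.

Definition pair_map (X Y : Type) (f : X -> Y) (p : X * X) : Y * Y :=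
  (f p.1, f p.2).

Definition triple_map (X Y : Type) (f : X -> Y) (t : X * X * X) : Y * Y * Y :=
  (f t.1.1, f t.1.2, f t.2).

Lemma r_map_morph (S T : weakLeftStarBrace) (f : S -> T) z p :
  brace_morphism f -> pair_map f (r_map z p) = r_map (f z) (pair_map f p).
Proof.
move=> fm; case: p => a b; rewrite /r_map /pair_map /=.
by rewrite !(morph_star fm, morph_mul fm, morph_add fm, morph_opp fm).
Qed.

Lemma rcheck_map_morph (S T : weakLeftStarBrace) (f : S -> T) z p :
  brace_morphism f ->
  pair_map f (rcheck_map z p) = rcheck_map (f z) (pair_map f p).
Proof.
move=> fm; case: p => a b; rewrite /rcheck_map /pair_map /=.
by rewrite !(morph_star fm, morph_mul fm, morph_add fm, morph_opp fm).
Qed.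

Section TripleMap.

Variables (X Y : Type) (f : X -> Y) (r : X * X -> X * X) (r' : Y * Y -> Y * Y).
Hypothesis fr : forall p, pair_map f (r p) = r' (pair_map f p).

Lemma map12_morph t : triple_map f (map12 r t) = map12 r' (triple_map f t).
Proof.
case: t => [[a b] c]; have := fr (a, b); rewrite /triple_map /map12 /pair_map /=.
by move=> <-; case: (r _).
Qed.

Lemma map23_morph t : triple_map f (map23 r t) = map23 r' (triple_map f t).
Proof.
case: t => [[a b] c]; have := fr (b, c); rewrite /triple_map /map23 /pair_map /=.
by move=> <-; case: (r _).
Qed.

End TripleMap.

(** * Localization of a dual brace at a projection *)

Section Localization.

Variable S : weakLeftStarBrace.
Hypothesis dualS : is_dual S.
Implicit Types x y e f g : S.

Let rssA := wb_add_rss S.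
Let rssM := wb_mul_rss S.
Local Notation proj := (projection wb_mul wb_star).
Local Notation addA := (opA rssA).
Local Notation mulA := (opA rssM).
Local Notation "x ≼ y" := (below wb_mul x y) (at level 70).

Lemma mul_moves f x y z : proj f -> y * f * x * z = y * x * f * z.
Proof.
exact: (projection_moves rssM (mul_normal dualS) (mul_completely_regular dualS)).
Qed.

Lemma add_moves f x y z : proj f -> y + f + x + z = y + x + f + z.
Proof.
move=> /proj_add.
exact: (projection_moves rssA (add_normal dualS) (add_completely_regular dualS)).
Qed.

Lemma below_factor a x b : a * x * b ≼ x.
Proof. by exists a, b. Qed.

Lemma below_mull x y : x * y ≼ x.
Proof. by exists (x * x^*), y; rewrite (op_inv_op rssM). Qed.

Lemma below_mulr x y : x * y ≼ y.
Proof. by exists x, (y^* * y); rewrite !mulA -!(mulA x) (op_inv_op rssM). Qed.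

Lemma below_star x : x^* ≼ x.
Proof. by exists x^*, x^*; rewrite (inv_op_inv rssM). Qed.

Lemma below_starr x : x ≼ x^*.
Proof. by exists x, x; rewrite (op_inv_op rssM). Qed.

(** The additive ideal preorder refines the multiplicative one: the additive support identity
    becomes a product of projections through [proj_mul] and [mul_proj], and that product has [x] as
    a factor. *)
Lemma below_summand a x b : a + x + b ≼ x.
Proof.
set t := a + x + b.
have [pt px] := (projection_right rssM t, projection_right rssM x).
have : below wb_add t x by exists a, b.
move/(below_support rssA (add_normal dualS) (add_completely_regular dualS)).
rewrite !dualS -(proj_mul dualS _ pt) -(mul_proj dualS _ pt) => H.
have := congr1 (wb_mul t) H; rewrite !mulA !(op_inv_op rssM) => E.
by exists (t * x^*), (t^* * t); rewrite !mulA E.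
Qed.

Lemma below_addl x y : x + y ≼ x.
Proof.
by have := below_summand (x - x) x y; rewrite (op_inv_op rssA).
Qed.

Lemma below_addr x y : x + y ≼ y.
Proof.
have := below_summand x y (- y + y).
by rewrite -!addA (addA y) (op_inv_op rssA).
Qed.

Lemma below_prod t x y : t ≼ x -> t ≼ y -> t ≼ x * y.
Proof.
exact: (below_mul rssM (mul_normal dualS) (mul_completely_regular dualS)).
Qed.

Section LocalGroup.

Variable e : S.
Hypothesis pe : proj e.

Definition sandwich x := e * x * e.

(** The sandwich is also [e + x + e], and [e] moves freely inside words of either operation. *)
Lemma sandwich_morphism : brace_morphism sandwich.
Proof.
have sE x : sandwich x = e + x + e.
  by rewrite /sandwich -mulA (mul_proj dualS _ pe) (proj_mul dualS _ pe).
split=> [x y|x y|x|x].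
- rewrite !sE !addA -(addA _ e e) (proj_addxx pe) -!(addA _ y e).
  by rewrite -(add_moves _ _ _ pe) (proj_addxx pe).
- exact: (sandwich_mul rssM (mul_normal dualS) (mul_completely_regular dualS)).
- by rewrite !sE !(opinvM rssA) (proj_opp pe) addA.
- by rewrite /sandwich !(opinvM rssM) pe.2 mulA.
Qed.

(** The maximal subgroup with identity [e]; by duality and [wb_idem] it is the same for both
    operations. *)
Definition unit_group x := x^* * x = e /\ x * x^* = e.

Lemma unit_group_add x y : unit_group x -> unit_group y -> unit_group (x + y).
Proof.
move=> [lx rx] [ly ry]; split.
- rewrite -dualS (opinvM rssA) addA -(addA x) dualS ly -{1}rx.
  by rewrite add_mul_star dualS.
- rewrite -wb_idem (opinvM rssA) addA -(addA (- y)) wb_idem rx -{1}ly -addA.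
  by rewrite star_mul_add // wb_idem.
Qed.

Lemma unit_group_mul x y : unit_group x -> unit_group y -> unit_group (x * y).
Proof.
move=> [lx rx] [ly ry]; split.
- by rewrite (opinvM rssM) mulA -(mulA y^*) lx -{1}ry mulA (inv_op_inv rssM).
- by rewrite (opinvM rssM) mulA -(mulA x) ry -{1}lx mulA (op_inv_op rssM).
Qed.

Lemma unit_group_opp x : unit_group x -> unit_group (- x).
Proof. by move=> [lx rx]; split; rewrite ?opp_star ?mul_opp_star. Qed.

Lemma unit_group_star x : unit_group x -> unit_group x^*.
Proof. by move=> [lx rx]; split; rewrite (opinvK rssM). Qed.

(** The inner copies of [e] can be moved to the ends, leaving [e * y^* * y * e], which is [e] by
    [below_support]. *)
Lemma unit_group_sandwich x : e ≼ x -> unit_group (sandwich x).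
Proof.
have key y : e ≼ y -> (sandwich y)^* * sandwich y = e.
  move=> /(fun ey => below_trans rssM ey (below_starr y)).
  move/(below_support rssM (mul_normal dualS) (mul_completely_regular dualS)).
  rewrite pe.2 pe.1 (opinvK rssM) !mulA => H.
  rewrite -[in RHS]H -(morph_star sandwich_morphism) /sandwich -(mulA _ e e) pe.1.
  by rewrite -!(mulA _ y e) -(mul_moves _ _ _ pe) pe.1.
move=> ex; split; first exact: key.
have := key x^* (below_trans rssM ex (below_starr x)).
by rewrite (morph_star sandwich_morphism) (opinvK rssM).
Qed.

Definition local_sort := {x : S | unit_group x}.

Definition local_add (u v : local_sort) : local_sort :=
  exist _ _ (unit_group_add (proj2_sig u) (proj2_sig v)).
Definition local_mul (u v : local_sort) : local_sort :=
  exist _ _ (unit_group_mul (proj2_sig u) (proj2_sig v)).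
Definition local_opp (u : local_sort) : local_sort :=
  exist _ _ (unit_group_opp (proj2_sig u)).
Definition local_star (u : local_sort) : local_sort :=
  exist _ _ (unit_group_star (proj2_sig u)).

Lemma local_inj (u v : local_sort) : proj1_sig u = proj1_sig v -> u = v.
Proof. by case: u v => [x px] [y py]; apply: subset_eq_compat. Qed.

Lemma local_add_rss : regular_star_semigroup local_add local_opp.
Proof.
split=> [x y w|x|x|x y]; apply: local_inj; rewrite /=.
- exact: addA.
- exact: (op_inv_op rssA).
- exact: (opinvK rssA).
- exact: (opinvM rssA).
Qed.

Lemma local_mul_rss : regular_star_semigroup local_mul local_star.
Proof.
split=> [x y w|x|x|x y]; apply: local_inj; rewrite /=.
- exact: mulA.
- exact: (op_inv_op rssM).
- exact: (opinvK rssM).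
- exact: (opinvM rssM).
Qed.

Lemma local_distr u v w : local_mul u (local_add v w) =
  local_add (local_add (local_mul u v) (local_opp u)) (local_mul u w).
Proof. by apply: local_inj; apply: wb_distr. Qed.

Lemma local_idem u : local_add (local_opp u) u = local_mul u (local_star u).
Proof. by apply: local_inj; apply: wb_idem. Qed.

Definition local_brace : weakLeftStarBrace :=
  WeakLeftStarBrace local_add_rss local_mul_rss local_distr local_idem.

Definition local_val (u : local_brace) : S := proj1_sig u.

Lemma local_val_morphism : brace_morphism local_val.
Proof. by split. Qed.

Lemma unit_group_e : unit_group e.
Proof. by split; rewrite pe.2 pe.1. Qed.

Definition local_one : local_brace := exist _ _ unit_group_e.

Lemma local_subrr (u : local_brace) : u - u = local_one.
Proof. by apply: local_inj; rewrite /= dualS (proj2_sig u).1. Qed.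

Lemma local_addNr (u : local_brace) : - u + u = local_one.
Proof. by apply: local_inj; rewrite /= wb_idem (proj2_sig u).2. Qed.

End LocalGroup.

End Localization.

(** A family given by one formula in all braces can be compared in [S] and in a local brace through
    the sandwich and the inclusion. *)
Definition natural (F : forall T : weakLeftStarBrace, T -> T * T -> T * T) :=
  forall (T T' : weakLeftStarBrace) (h : T -> T') x p, brace_morphism h ->
    pair_map h (F T x p) = F T' (h x) (pair_map h p).

Lemma natural_comp F G : natural F -> natural G ->
  natural (fun T x => F T x \o G T x).
Proof. by move=> natF natG T T' h x p hm; rewrite /= natF // natG. Qed.

Lemma natural_r_map : natural r_map.
Proof. by move=> T T' h x p; apply: r_map_morph. Qed.

Lemma natural_rcheck_map_star : natural (fun T x => rcheck_map x^*).
Proof.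
by move=> T T' h x p hm; rewrite (rcheck_map_morph _ _ hm) (morph_star hm).
Qed.

(** * Lifting equalities from local skew braces: supports and outer projections *)

Section Transfer.

Variable S : weakLeftStarBrace.
Hypothesis dualS : is_dual S.
Implicit Types (x y z e f g : S) (p P : S * S).

Let rssA := wb_add_rss S.
Let rssM := wb_mul_rss S.
Local Notation proj := (projection wb_mul wb_star).
Local Notation addA := (opA rssA).
Local Notation mulA := (opA rssM).
Local Notation "x ≼ y" := (below wb_mul x y) (at level 70).

Lemma below_self_mul_star x y : x ≼ y -> x ≼ y * y^*.
Proof.
move=> xy; apply: (below_trans rssM xy).
by rewrite -{1}(op_inv_op rssM y); apply: below_mull.
Qed.

Lemma mul_star_below x y : x ≼ y -> x * x^* ≼ y.
Proof. by move=> xy; apply: (below_trans rssM _ xy); apply: below_mull. Qed.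

Lemma eq_of_sandwich e f g x y :
  proj e -> proj f -> proj g -> x ≼ e -> y ≼ e ->
  f * x = x -> f * y = y -> x * g = x -> y * g = y ->
  sandwich e x = sandwich e y -> x = y.
Proof.
move=> pe pf pg xe ye.
apply: (sandwich_inj rssM (mul_normal dualS) (mul_completely_regular dualS)
          pe pf pg xe ye).
  exact: (below_trans rssM (below_star x) xe).
exact: (below_trans rssM (below_star y) ye).
Qed.

Definition all_below p x := p.1 ≼ x /\ p.2 ≼ x.

Lemma all_below_r_map z p x :
  p.1 ≼ x \/ p.2 ≼ x \/ z ≼ x -> all_below (r_map z p) x.
Proof.
case: p => a b /=; set u := _ * _ * _ * z^* * z => H.
have ux : u ≼ x.
  case: H => [ax|[bx|zx]].
  - apply: (below_trans rssM _ ax); apply: (below_trans rssM (below_mull _ _)).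
    apply: (below_trans rssM (below_mull _ _)).
    apply: (below_trans rssM (below_mulr _ _)).
    apply: (below_trans rssM (below_addr dualS _ _)); rewrite -mulA.
    exact: below_mull.
  - apply: (below_trans rssM _ bx); apply: (below_trans rssM (below_mull _ _)).
    apply: (below_trans rssM (below_mull _ _)).
    apply: (below_trans rssM (below_mulr _ _)).
    apply: (below_trans rssM (below_addr dualS _ _)).
    exact: below_factor.
  - exact: (below_trans rssM (below_mulr _ _) zx).
split=> //; apply: (below_trans rssM _ ux).
exact: (below_trans rssM (below_mull _ _) (below_star _)).
Qed.

Lemma all_below_rcheck_map z p x :
  p.1 ≼ x \/ p.2 ≼ x \/ z ≼ x -> all_below (rcheck_map z p) x.
Proof.
case: p => a b /=; set u := _ * z * z^* => H.
have ux : u ≼ x.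
  case: H => [ax|[bx|zx]].
  - apply: (below_trans rssM _ ax); apply: (below_trans rssM (below_mull _ _)).
    apply: (below_trans rssM (below_mull _ _)).
    apply: (below_trans rssM (below_addl dualS _ _)).
    apply: (below_trans rssM (below_addl dualS _ _)).
    exact: below_mull.
  - apply: (below_trans rssM _ bx); apply: (below_trans rssM (below_mull _ _)).
    apply: (below_trans rssM (below_mull _ _)).
    apply: (below_trans rssM (below_addl dualS _ _)).
    apply: (below_trans rssM (below_addl dualS _ _)).
    exact: below_mulr.
  - apply: (below_trans rssM _ zx); exact: below_factor.
split=> //; apply: (below_trans rssM _ ux).
exact: (below_trans rssM (below_mull _ _) (below_star _)).
Qed.

(** The common outer projections needed by [eq_of_sandwich]: [f] at every end except the right end
    of the second component, where it is [g]. *)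
Definition bounded f g p :=
  f * p.1 = p.1 /\ p.1 * f = p.1 /\ f * p.2 = p.2 /\ p.2 * g = p.2.

Lemma bounded_pair f g u a b : proj f -> f * u = u -> u * f = u -> b * g = b ->
  bounded f g (u, u^* * (a * b)).
Proof.
move=> pf fu uf bg; do 2?split => //; rewrite /= ?mulA; split.
  by rewrite -{1}uf (opinvM rssM) pf.2 mulA pf.1 -{2}uf (opinvM rssM) pf.2.
by rewrite -mulA bg.
Qed.

Lemma bounded_r_map z p g : p.2 * g = p.2 ->
  bounded (z^* * z) g (r_map z p).
Proof.
case: p => a b /= bg; have pz := projection_right rssM z.
have zz x : x * z^* * z * (z^* * z) = x * z^* * z by rewrite -!(mulA x) pz.1.
apply: bounded_pair => //.
by rewrite !mulA (inv_op_inv rssM).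
Qed.

Lemma bounded_rcheck_map z p g : p.2 * g = p.2 ->
  bounded (z * z^*) g (rcheck_map z p).
Proof.
case: p => a b /= bg; have pz := projection_left rssM z.
have uz x : x * z * z^* * (z * z^*) = x * z * z^*.
  by rewrite -!(mulA x) pz.1.
apply: bounded_pair => //.
(* Multiplying by [z * z^*] on the left adds it on the right, where the last summand [z] absorbs
   it. *)
rewrite (proj_mul dualS _ pz) -!(mulA _ z) (mul_proj dualS _ pz) -!addA.
by rewrite add_mul_star.
Qed.

Lemma eq_pair_of_sandwich e f g p P : proj e -> proj f -> proj g ->
  all_below p e -> all_below P e -> bounded f g p -> bounded f g P ->
  pair_map (sandwich e) p = pair_map (sandwich e) P -> p = P.
Proof.
case: p P => [u v] [u' v'] pe pf pg [/= ue ve] [/= u'e v'e].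
move=> [/= fu [uf [fv vg]]] [/= fu' [u'f [fv' v'g]]] [] uu vv.
have -> := eq_of_sandwich pe pf pf ue u'e fu fu' uf u'f uu.
by have -> := eq_of_sandwich pe pf pg ve v'e fv fv' vg v'g vv.
Qed.

Lemma map_group_lift z x : proj z -> z ≼ x ->
  exists u : local_brace dualS z, local_val u = sandwich z x.
Proof.
by move=> pz zx; exists (exist _ _ (unit_group_sandwich dualS pz zx)).
Qed.

(** The identity for [z] is pushed through the sandwich morphism, which fixes the elements of the
    local group. *)
Lemma local_right_distributor e z (u : local_brace dualS e) :
  proj e -> local_val u = sandwich e z -> right_distributor z ->
  right_distributor u.
Proof.
move=> pe uz zD x y; apply: local_inj; have sm := sandwich_morphism dualS pe.
have fixed (w : local_brace dualS e) : sandwich e (local_val w) = local_val w.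
  case: w => w [lw rw]; rewrite /sandwich /= -{1}rw (op_inv_op rssM).
  by rewrite -lw mulA (op_inv_op rssM).
have := congr1 (sandwich e) (zD (local_val x) (local_val y)).
by rewrite !(morph_add sm, morph_mul sm, morph_opp sm) !fixed -uz.
Qed.

(** * The Yang-Baxter equation and identities between maps on pairs, for a fixed right
    distributor *)

Section Fixed.

Variable z : S.
Hypothesis zD : right_distributor z.

Lemma YBE_rcheck_map : YBE_solution (rcheck_map z).
Proof.
(* This [e] lies below [a], [b], [c] and [z], and whatever lies below all four lies below [e]. *)
move=> [[a b] c]; set w := a * b * c * z; set e := w * w^*.
have pe : proj e := projection_left rssM w.
have ez : e ≼ z by apply: mul_star_below; apply: below_mulr.
have ec : e ≼ c by apply: mul_star_below; exact: below_factor.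
have eb : e ≼ b.
  by apply: mul_star_below; rewrite /w -(mulA _ c); exact: below_factor.
have ea : e ≼ a by apply: mul_star_below; rewrite /w -!mulA; exact: below_mull.
have below_e t : t ≼ a -> t ≼ b -> t ≼ c -> t ≼ z -> t ≼ e.
  by move=> ta tb tc tz; apply: below_self_mul_star; do !apply: (below_prod dualS).
have [A Aa] := map_group_lift pe ea.
have [B Bb] := map_group_lift pe eb.
have [C Cc] := map_group_lift pe ec.
have [Z Zz] := map_group_lift pe ez.
have ZD := local_right_distributor pe Zz zD.
have locE : triple_map (sandwich e) (a, b, c) =
    triple_map (@local_val _ dualS e) (A, B, C).
  by rewrite /triple_map /= Aa Bb Cc.
have E : triple_map (sandwich e)
    ((map12 (rcheck_map z) \o map23 (rcheck_map z) \o map12 (rcheck_map z))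
       (a, b, c)) =
  triple_map (sandwich e)
    ((map23 (rcheck_map z) \o map12 (rcheck_map z) \o map23 (rcheck_map z))
       (a, b, c)).
  have fs p := rcheck_map_morph z p (sandwich_morphism dualS pe).
  have fv q := rcheck_map_morph Z q (local_val_morphism dualS e).
  rewrite /comp !(map12_morph fs, map23_morph fs) locE -Zz.
  rewrite -!(map12_morph fv, map23_morph fv); congr triple_map.
  exact: (skew_YBE (local_subrr pe) (local_addNr pe) ZD (A, B, C)).
have pz := projection_left rssM z; have pc := projection_right rssM c.
have cc : c * (c^* * c) = c by rewrite mulA (op_inv_op rssM).
have bnd p g := @bounded_rcheck_map z p g.
have below_r p x : p.1 ≼ x \/ p.2 ≼ x \/ z ≼ x -> all_below (rcheck_map z p) x.
  exact: all_below_rcheck_map.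
have self x : x ≼ x by exists (x * x^*), (x^* * x); rewrite !mulA !(op_inv_op rssM).
have [[sa sb] [sc sz]] := ((self a, self b), (self c, self z)).
move: (rcheck_map z) bnd below_r E => r bnd below_r E.
(* Each intermediate pair is named together with its outer projections and its bounds in the ideal
   preorder. *)
have bnd1 := bnd (a, b); have blw1 := below_r (a, b).
case Er1: (r (a, b)) bnd1 blw1 => [a1 b1] bnd1 blw1.
have bnd2 := bnd (b1, c); have blw2 := below_r (b1, c).
case Er2: (r (b1, c)) bnd2 blw2 => [b2 c2] bnd2 blw2.
have bnd3 := bnd (a1, b2); have blw3 := below_r (a1, b2).
case Er3: (r (a1, b2)) bnd3 blw3 => [a3 b3] bnd3 blw3.
have bnd4 := bnd (b, c); have blw4 := below_r (b, c).
case Er4: (r (b, c)) bnd4 blw4 => [b4 c4] bnd4 blw4.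
have bnd5 := bnd (a, b4); have blw5 := below_r (a, b4).
case Er5: (r (a, b4)) bnd5 blw5 => [a5 b5] bnd5 blw5.
have bnd6 := bnd (b5, c4); have blw6 := below_r (b5, c4).
case Er6: (r (b5, c4)) bnd6 blw6 => [b6 c6] bnd6 blw6.
have {}blw2 x : a ≼ x \/ b ≼ x \/ c ≼ x \/ z ≼ x -> all_below (b2, c2) x.
  by move=> H; have /= := blw1 x; have /= := blw2 x; rewrite /all_below /=; tauto.
have {}blw3 x : a ≼ x \/ b ≼ x \/ c ≼ x \/ z ≼ x -> all_below (a3, b3) x.
  by move=> H; have /= := blw2 x H; have /= := blw3 x; rewrite /all_below /=; tauto.
have {}blw5 x : a ≼ x \/ b ≼ x \/ c ≼ x \/ z ≼ x -> all_below (a5, b5) x.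
  by move=> H; have /= := blw4 x; have /= := blw5 x; rewrite /all_below /=; tauto.
have {}blw6 x : a ≼ x \/ b ≼ x \/ c ≼ x \/ z ≼ x -> all_below (b6, c6) x.
  by move=> H; have /= := blw5 x H; have /= := blw6 x; rewrite /all_below /=; tauto.
have all_e u v :
    (forall x, a ≼ x \/ b ≼ x \/ c ≼ x \/ z ≼ x -> all_below (u, v) x) ->
    u ≼ e /\ v ≼ e.
  by move=> H; split; apply: below_e; apply H; auto.
have [a3e b3e] := all_e _ _ blw3; have [_ c2e] := all_e _ _ blw2.
have [a5e _] := all_e _ _ blw5; have [b6e c6e] := all_e _ _ blw6.
(* The right projection of [c] passes to the third coordinates; all other ends of the final
   coordinates are fixed by [z * z^*]. *)
have [/= _ [b2f [fc2 c2c]]] := bnd2 _ cc.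
have [/= fa3 [a3f [fb3 b3f]]] := bnd3 _ b2f.
have [/= _ [b4f [_ c4c]]] := bnd4 _ cc.
have [/= fa5 [a5f _]] := bnd5 _ b4f.
have [/= fb6 [b6f [fc6 c6c]]] := bnd6 _ c4c.
move: E; rewrite /= ?Er1 ?Er4 /= ?Er2 ?Er5 /= ?Er3 ?Er6 => -[a35 b36 c26].
have -> := eq_of_sandwich pe pz pz a3e a5e fa3 fa5 a3f a5f a35.
have -> := eq_of_sandwich pe pz pz b3e b6e fb3 fb6 b3f b6f b36.
by have -> := eq_of_sandwich pe pz pc c2e c6e fc2 fc6 c2c c6c c26.
Qed.

Definition supported (r : S * S -> S * S) := forall p x,
  p.1 ≼ x \/ p.2 ≼ x \/ z ≼ x -> all_below (r p) x.

Lemma supported_comp r r' : supported r -> supported r' -> supported (r \o r').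
Proof.
move=> sr sr' p x H; apply: sr; left.
by have [] := sr' p x H.
Qed.

Lemma supported_r_map : supported (r_map z).
Proof. by move=> p x; apply: all_below_r_map. Qed.

Lemma supported_rcheck_map_star : supported (rcheck_map z^*).
Proof.
move=> p x H; apply: all_below_rcheck_map; case: H => [|[]]; auto.
by move=> zx; right; right; apply: (below_trans rssM (below_star z) zx).
Qed.

Definition bounded_map f (r : S * S -> S * S) := forall p g, p.2 * g = p.2 ->
  bounded f g (r p).

Lemma bounded_map_comp f r r' : bounded_map f r -> bounded_map f r' ->
  bounded_map f (r \o r').
Proof. by move=> br br' p g /br' [_ [_ [_ H]]]; apply: br. Qed.

Lemma bounded_map_r : bounded_map (z^* * z) (r_map z).
Proof. by move=> p g; apply: bounded_r_map. Qed.

Lemma bounded_map_rcheck_star : bounded_map (z^* * z) (rcheck_map z^*).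
Proof.
move=> p g; rewrite -{2}(opinvK rssM z); exact: bounded_rcheck_map.
Qed.

(** Naturality carries the skew brace identity from the local brace at [e] to the sandwiched values
    in [S]; the support and end conditions then allow [eq_pair_of_sandwich] to lift it. *)
Lemma transfer_pair (F G : forall T : weakLeftStarBrace, T -> T * T -> T * T)
    (f : S) :
  natural F -> natural G ->
  (forall (T : weakLeftStarBrace) (o : T), (forall x : T, x - x = o) ->
     (forall x : T, - x + x = o) -> forall x : T, right_distributor x ->
     F T x =1 G T x) ->
  supported (F S z) -> supported (G S z) -> proj f ->
  bounded_map f (F S z) -> bounded_map f (G S z) ->
  F S z =1 G S z.
Proof.
move=> natF natG skewFG belowF belowG pf bndF bndG [a b].
set w := a * b * z; set e := w * w^*.
have pe : proj e := projection_left rssM w.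
have ez : e ≼ z by apply: mul_star_below; apply: below_mulr.
have eb : e ≼ b by apply: mul_star_below; exact: below_factor.
have ea : e ≼ a by apply: mul_star_below; rewrite /w -mulA; exact: below_mull.
have self x : x ≼ x by exists (x * x^*), (x^* * x); rewrite !mulA !(op_inv_op rssM).
have below_e x : x ≼ a -> x ≼ b -> x ≼ z -> x ≼ e.
  by move=> xa xb xz; apply: below_self_mul_star; do !apply: (below_prod dualS).
have [A Aa] := map_group_lift pe ea.
have [B Bb] := map_group_lift pe eb.
have [Z Zz] := map_group_lift pe ez.
have ZD := local_right_distributor pe Zz zD.
have sm := sandwich_morphism dualS pe; have vm := local_val_morphism dualS e.
have bb : b * (b^* * b) = b by rewrite mulA (op_inv_op rssM).
have all_e p : (forall x, (a ≼ x \/ b ≼ x \/ z ≼ x) -> all_below p x) ->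
    all_below p e.
  move=> H; split; apply: below_e; apply H; auto.
apply: (eq_pair_of_sandwich pe pf (projection_right rssM b)).
- exact: all_e (belowF (a, b)).
- exact: all_e (belowG (a, b)).
- exact: (bndF (a, b)).
- exact: (bndG (a, b)).
have locE : pair_map (sandwich e) (a, b) = pair_map (@local_val _ dualS e) (A, B).
  by rewrite /pair_map /= Aa Bb.
rewrite natF // natG // locE -Zz -natF // -natG //; congr pair_map.
exact: (skewFG _ _ (local_subrr pe) (local_addNr pe) _ ZD).
Qed.

End Fixed.

End Transfer.

Theorem theorem4p7 (S : weakLeftStarBrace) (z : S)
    (dualS : is_dual S) (zD : right_distributor z) :
  YBE_solution (rcheck_map z) /\
  r_map z \o rcheck_map z^* \o r_map z =1 r_map z /\
  rcheck_map z^* \o r_map z \o rcheck_map z^* =1 rcheck_map z^* /\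
  r_map z \o rcheck_map z^* =1 rcheck_map z^* \o r_map z.
Proof.
have pz := projection_right (wb_mul_rss S) z.
have [nr nc] := (natural_r_map, natural_rcheck_map_star).
have [sr sc] := (@supported_r_map S dualS z, @supported_rcheck_map_star S dualS z).
have [br bc] := (@bounded_map_r S z, @bounded_map_rcheck_star S dualS z).
split; first exact: YBE_rcheck_map.
have [nrc ncr] := (natural_comp nr nc, natural_comp nc nr).
have [src scr] := (supported_comp sr sc, supported_comp sc sr).
have [brc bcr] := (bounded_map_comp br bc, bounded_map_comp bc br).
split; [|split].
(* In a skew brace [r_map x] and [rcheck_map x^*] are mutually inverse, so all three identities are
   immediate there. *)
- apply: (transfer_pair dualS zD (natural_comp nrc nr) nr _
            (supported_comp src sr) sr pz (bounded_map_comp brc br) br).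
  move=> T o s0 n0 x xD p; exact: (skew_r_rcheck s0 n0 xD (r_map x p)).
- apply: (transfer_pair dualS zD (natural_comp ncr nc) nc _
            (supported_comp scr sc) sc pz (bounded_map_comp bcr bc) bc).
  move=> T o s0 n0 x xD p; exact: (skew_rcheck_r s0 n0 xD (rcheck_map x^* p)).
- apply: (transfer_pair dualS zD nrc ncr _ src scr pz brc bcr).
  move=> T o s0 n0 x xD p.
  exact: etrans (skew_r_rcheck s0 n0 xD p) (esym (skew_rcheck_r s0 n0 xD p)).
Qed.
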